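(* Let $V=\mathbb{F}_2^4$, $W=\mathbb{F}_2^3$, and let $q:V\to W$ be the quadratic map $q(w,x,y,z)=(wx+yz,\,wy,\,xy)$. Then $q$ is regular with $\langle b_q(V\times V)\rangle=W$, and the special $2$-group $G$ associated with $q$, which has order $128$, is totally orthogonal but not strongly real.
   Context: $\mathbb{F}_2$ is the field with two elements. A map $q: V\to W$ of $\mathbb{F}_2$-vector spaces is a quadratic map if $q(\alpha v)=\alpha^2 q(v)$ for all $\alpha\in\mathbb{F}_2$, $v \in V$, and $b_q(v,w) := q(v+w)-q(v)-q(w)$ is bilinear. It is regular if $\{w\in V : b_q(v,w)=0 \text{ for all } v\in V\}=0$. $\langle b_q(V\times V)\rangle$ is the subgroup of $W$ generated by the image of $b_q$. A finite $2$-group $G$ is special if it is non-commutative and $G' = \Phi(G) = Z(G) = \Omega(Z(G))$, where $G'=[G,G]$, $\Phi(G)$ is the Frattini subgroup, and $\Omega(H)=\langle x\in H : x^2=1\rangle$. For a regular quadratic map $q:V\to W$ between finite-dimensional spaces with $\langle b_q(V\times V)\rangle=W$, the special $2$-group $G$ associated with $q$ is the special $2$-group (unique up to isomorphism) with identifications (group isomorphisms) $G/Z(G)\cong V$ and $Z(G)\cong W$ under which $q$ is the map $xZ(G)\mapsto x^2$. Concretely, it is the set $V\times W$ with $(v,w)(v',w')=(v+v',c(v,v')+w+w')$, where $c:V\times V\to W$ is any normalized $2$-cocycle (for instance any bilinear map) with $c(v,v)=q(v)$ for all $v$. An element of a group is strongly real if it is a product of two elements each equal to its own inverse (i.e. elements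 $y$ with $y^2=1$, the identity allowed). A group is strongly real if all its elements are. A group is real if every element is conjugate to its inverse. A finite real group is totally orthogonal if it admits no symplectic representation, i.e. if all its (irreducible) complex representations are realizable over $\mathbb{R}$. *)

(* Defs.v *)
From HB Require Import structures.
From mathcomp Require Import all_boot all_order all_algebra all_fingroup.
From mathcomp Require Import all_solvable all_field mxrepresentation.
From mathcomp Require Import complex reals.

Set Implicit Arguments.
Unset Strict Implicit.
Unset Printing Implicit Defensive.

Import GRing.Theory.
Local Open Scope ring_scope.

Section QuadraticMap.

Variables V W : lmodType 'F_2.
Implicit Type q : V -> W.

Definition polar q (v w : V) : W := q (v + w) - q v - q w.

Definition quadratic_map q : Prop :=
  [/\ forall (a : 'F_2) (v : V), q (a *: v) = a ^+ 2 *: q v,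
      forall v : V, linear (polar q v)
    & forall w : V, linear (fun v => polar q v w)].

Definition regular_map q : Prop :=
  forall w : V, (forall v : V, polar q v w = 0) -> w = 0.

End QuadraticMap.

(* The subgroup of the additive group 'rV['F_2]_n generated by b_q(V x V). *)
Definition polar_span (m n : nat) (q : 'rV['F_2]_m -> 'rV['F_2]_n) :
    {set 'rV['F_2]_n} :=
  <<[set polar q v w | v in [set: 'rV['F_2]_m], w in [set: 'rV['F_2]_m]]>>%g.

(* The set 'Ldiv_2(H) is {x in H | x ^ 2 = 1}.  The library's [special] is not
   used because it also holds of the trivial group. *)
Definition special_2group (gT : finGroupType) (G : {group gT}) : Prop :=
  [/\ (2.-group G)%g, ~~ abelian G, G^`(1)%g = 'Phi(G)%g, 'Phi(G)%g = 'Z(G)%g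
    & 'Z(G)%g = <<'Ldiv_2('Z(G))>>%g].

(* G is the special 2-group associated with q: f and g are the identifications
   of G / Z(G) with V and of Z(G) with W, where vector spaces are seen as
   additive groups, and q corresponds to the squaring map x Z(G) |-> x ^ 2. *)
Definition associated_with (m n : nat) (q : 'rV['F_2]_m -> 'rV['F_2]_n)
    (gT : finGroupType) (G : {group gT}) : Prop :=
  special_2group G /\
  exists (f : {morphism (G / 'Z(G))%g >-> 'rV['F_2]_m})
         (g : {morphism 'Z(G)%g >-> 'rV['F_2]_n}),
    [/\ isom (G / 'Z(G))%g [set: 'rV['F_2]_m] f,
        isom 'Z(G)%g [set: 'rV['F_2]_n] g
      & forall x : gT, x \in G -> q (f (coset 'Z(G)%g x)) = g (x ^+ 2)%g].

Definition strongly_real_elt (gT : finGroupType) (G : {group gT}) (x : gT) :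
    Prop :=
  exists a b : gT,
    [/\ a \in G, b \in G, (a^-1 = a)%g, (b^-1 = b)%g & x = (a * b)%g].

Definition strongly_real (gT : finGroupType) (G : {group gT}) : Prop :=
  forall x : gT, x \in G -> strongly_real_elt G x.

Definition real_group (gT : finGroupType) (G : {group gT}) : Prop :=
  forall x : gT, x \in G -> (x^-1 \in x ^: G)%g.

Definition realizable_over_reals (R : realType) (gT : finGroupType)
    (G : {group gT}) (d : nat) (rG : mx_representation R[i] G d) : Prop :=
  exists rG0 : mx_representation R G d,
    mx_rsim rG (map_repr (real_complex R) rG0).

Definition totally_orthogonal (R : realType) (gT : finGroupType)
    (G : {group gT}) : Prop :=
  real_group G /\
  forall (d : nat) (rG : mx_representation R[i] G d),
    mx_irreducible rG -> realizable_over_reals rG.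

(* 0, 1, 2, 3 are the four elements of 'I_4, by its ring structure modulo 4. *)
Definition q_example (v : 'rV['F_2]_4) : 'rV['F_2]_3 :=
  let w := v 0 0 in let x := v 0 1 in let y := v 0 2 in let z := v 0 3 in
  \row_(i < 3) [:: w * x + y * z; w * y; x * y]`_i.

(* Main.v *)
Require Import Defs.
From HB Require Import structures.
From mathcomp Require Import all_boot all_order all_algebra all_fingroup.
From mathcomp Require Import all_solvable all_field mxrepresentation.
From mathcomp Require Import complex reals.
From mathcomp Require Import ring.

Set Implicit Arguments.
Unset Strict Implicit.
Unset Printing Implicit Defensive.

Import GRing.Theory Num.Theory.
Local Open Scope ring_scope.

(** Write [e_w, e_x, e_y, e_z] for the standard basis of V. The form q vanishes on each
    basis vector, so their lifts [h_w, h_x, h_y, h_z] to G are involutions that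
    generate G modulo the centre, and the only nontrivial commutators are
    [[h_w, h_x] = [h_y, h_z]], [[h_w, h_y]] and [[h_x, h_y]]. In an irreducible
    representation the centre acts by signs. Starting from a common eigenvector v
    of a maximal commuting set of the h's, the distinct lines among
    v, v h_w, v h_y, v h_w h_y carry pairwise different eigenvalues, hence are
    independent, and G permutes these vectors up to sign: in this basis the
    representation is real.

    The squaring map and the commutator of G are q and its polar form.  So G is
    real as soon as each q(v) is a value of b_q(v, -), and if G is strongly real
    then each v is a sum of two zeros of q; the vector (1,1,1,0) is not. *)

(** * Matrices permuting vectors up to sign, and independence of eigenvectors *)

Section SignedStable.

Variables (F : fieldType) (d : nat).
Implicit Types (s : seq 'rV[F]_d) (M N : 'M[F]_d).

(** The property passes to products and sign multiples, so for a group it can be tested on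
    generators modulo a centre that acts by signs. *)
Definition signed_stable s M : Prop :=
  forall u, u \in s ->
    exists b : bool, exists2 u', u' \in s & u *m M = (-1) ^+ b *: u'.

Lemma signed_stable1 s : signed_stable s 1%:M.
Proof. by move=> u su; exists false, u; rewrite // mulmx1 scale1r. Qed.

Lemma signed_stableM s M N :
  signed_stable s M -> signed_stable s N -> signed_stable s (M *m N).
Proof.
move=> sM sN u /sM[b [u' /sN[c [u'' su'' eN]] eM]].
exists (b (+) c), u'' => //.
by rewrite mulmxA eM -scalemxAl eN scalerA signr_addb.
Qed.

Lemma signed_stableZ s M (b : bool) :
  signed_stable s M -> signed_stable s ((-1) ^+ b *: M).
Proof.
move=> sM u /sM[c [u' su' eM]]; exists (b (+) c), u' => //.
by rewrite -scalemxAr eM scalerA signr_addb.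
Qed.

(** [v + v *m M] is fixed by [M]; if it vanishes, [v] itself has eigenvalue -1. The last clause
    carries over the eigenvalues of matrices commuting with [M], so repeated use yields common
    eigenvectors. *)
Lemma sign_eigenvector M (v : 'rV[F]_d) :
  v != 0 -> M *m M = 1%:M ->
  exists (u : 'rV[F]_d) (b : bool), [/\ u != 0, u *m M = (-1) ^+ b *: u
    & forall N (a : F), M *m N = N *m M -> v *m N = a *: v -> u *m N = a *: u].
Proof.
move=> nz_v MM; have [vM0 | nz_vM] := eqVneq (v + v *m M) 0.
  exists v, true; split=> //; rewrite expr1 scaleN1r.
  by apply/eqP; rewrite -addr_eq0 addrC vM0.
exists (v + v *m M), false; split=> // [|N a cMN vN].
  by rewrite mulmxDl -mulmxA MM mulmx1 scale1r addrC.
by rewrite mulmxDl -mulmxA cMN mulmxA vN -scalemxAl scalerDr.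
Qed.

(** A linear relation puts each [u 0 i *: row i B] both in its own eigenspace and in the sum of the
    others, and eigenspaces of distinct eigenvalues are in direct sum. *)
Lemma eigenvectors_row_free k (B : 'M[F]_(k, d)) M (a : 'I_k -> F) :
    injective a -> (forall i, row i B != 0) ->
    (forall i, row i B *m M = a i *: row i B) ->
  row_free B.
Proof.
move=> inj_a nzB eigB; rewrite -kermx_eq0; apply/rowV0P => u.
move/sub_kermxP; rewrite mulmx_sum_row => uB0.
have eig i : (u 0 i *: row i B <= eigenspace M (a i))%MS.
  by rewrite scalemx_sub //; apply/eigenspaceP.
have inj_aP : {in predT &, injective a} by move=> i j _ _; apply: inj_a.
apply/rowP=> i; rewrite mxE; apply/eqP.
have/mxdirect_sumsP/(_ i isT) dx := mxdirect_sum_eigenspace M inj_aP.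
have: (u 0 i *: row i B <= (0 : 'M[F]_d))%MS.
  rewrite -dx sub_capmx eig /=.
  move/eqP: uB0; rewrite (bigD1 i) //= addr_eq0 => /eqP->.
  by rewrite eqmx_opp summx_sub_sums.
by rewrite submx0 scaler_eq0 (negPf (nzB i)) orbF.
Qed.

End SignedStable.

(** * Descent of an irreducible representation to a subfield *)

(** The row space of [B] is a nonzero submodule, hence everything, so [B] is a change of basis. The
    matrices [S] multiply as [rG] does because [f] is injective and [B] invertible. *)
Lemma irreducible_realizable_over (K F : fieldType) (f : {rmorphism K -> F})
    (gT : finGroupType) (G : {group gT}) d (rG : mx_representation F G d)
    k (B : 'M[F]_(k, d)) :
    mx_irreducible rG -> B != 0 -> row_free B ->
    (forall x, x \in G -> exists S : 'M[K]_k, B *m rG x = map_mx f S *m B) ->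
  exists rK : mx_representation K G d, mx_rsim rG (map_repr f rK).
Proof.
move=> /mx_irrP[d_gt0 irrG] nzB freeB realB.
have fullB : row_full B.
  suff: row_full <<B>>%MS by rewrite -!sub1mx genmxE.
  apply: irrG; last by rewrite -mxrank_eq0 genmxE mxrank_eq0.
  apply/mxmoduleP=> x Gx; rewrite (eqmxMr _ (genmxE B)) (genmxE B).
  by have [S ->] := realB x Gx; apply: submxMl.
have kd : k = d by move/eqP: freeB; move/eqP: fullB => -> ->.
subst k; have uB : B \in unitmx by rewrite -row_free_unit.
have /fin_all_exists[S defS] x : exists S : 'M[K]_d,
    x \in G -> B *m rG x = map_mx f S *m B.
  by case Gx: (x \in G); [have [S ?] := realB x Gx; exists S | exists 0].
have inj S1 S2 : map_mx f S1 *m B = map_mx f S2 *m B -> S1 = S2.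
  by move=> /(can_inj (mulmxK uB)) /map_mx_inj.
have reprS : mx_repr G S.
  split=> [|x y Gx Gy]; apply: inj.
    by rewrite -defS // repr_mx1 map_mx1 mulmx1 mul1mx.
  by rewrite -defS ?groupM // repr_mxM // mulmxA defS // -mulmxA defS // map_mxM mulmxA.
exists (MxRepresentation reprS); exists (invmx B) => //.
  by rewrite row_free_unit unitmx_inv.
move=> x Gx; rewrite /= /map_repr_mx /=.
by rewrite -[LHS](mulKmx uB) (mulmxA B) (defS x Gx) (mulmxK uB).
Qed.

(** Different eigenvalues of [N] make [s] independent, and in this basis group elements have entries
    0, 1 and -1, which exist in [K]. Distinct integers stay distinct in [F], which has
    characteristic 0. *)
Lemma signed_frame_realizable (K : fieldType) (F : numFieldType)
    (f : {rmorphism K -> F}) (gT : finGroupType) (G : {group gT}) d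
    (rG : mx_representation F G d) (s : seq 'rV[F]_d) (N : 'M[F]_d)
    (l : seq int) :
    mx_irreducible rG -> size s = size l -> (0 < size s)%N ->
    uniq l -> 0 \notin s ->
    (forall i, (i < size s)%N -> s`_i *m N = (l`_i)%:~R *: s`_i) ->
    (forall x, x \in G -> signed_stable s (rG x)) ->
  exists rK : mx_representation K G d, mx_rsim rG (map_repr f rK).
Proof.
move=> irrG sz s_gt0 uniq_l nzs eig stab.
pose B := \matrix_(i < size s) s`_i.
have nzB (i : 'I_(size s)) : row i B != 0.
  by rewrite rowK; apply: contraNneq nzs => <-; apply: mem_nth.
apply: (irreducible_realizable_over irrG (B := B)) => [||x Gx].
- by apply: contraNneq (nzB (Ordinal s_gt0)) => ->; rewrite row0.
- apply: (eigenvectors_row_free (M := N) (a := fun i => (l`_i)%:~R)) => // [i j|i].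
    move/intr_inj/eqP; rewrite nth_uniq -?sz //; exact: (fun e => val_inj (eqP e)).
  by rewrite rowK eig.
have /fin_all_exists[c defc] (i : 'I_(size s)) : exists c : bool * 'I_(size s),
    s`_i *m rG x = (-1) ^+ c.1 *: s`_(c.2).
  have [b [u su ->]] := stab x Gx s`_i (mem_nth _ (ltn_ord i)).
  have lt_j : (index u s < size s)%N by rewrite index_mem.
  by exists (b, Ordinal lt_j); rewrite /= nth_index.
exists (\matrix_i ((-1) ^+ (c i).1 *: delta_mx 0 (c i).2)).
apply/row_matrixP=> i; rewrite !row_mul !rowK -map_row rowK defc.
by rewrite map_mxZ rmorph_sign map_delta_mx -scalemxAl -rowE rowK.
Qed.

(** The matrices stand for the images of [h_w], [h_x], [h_y], [h_z], and [e1], [e2], [e3] for the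
    signs of the three commutators. The frame has four vectors if [e1] holds; otherwise two if [e2]
    or [e3] holds, and one if neither does. *)
Lemma signed_frame_of_generators (F : numFieldType) d
    (Mw Mx My Mz : 'M[F]_d) (e1 e2 e3 : bool) :
    (0 < d)%N ->
    [/\ Mw *m Mw = 1%:M, Mx *m Mx = 1%:M, My *m My = 1%:M & Mz *m Mz = 1%:M] ->
    Mw *m Mx = (-1) ^+ e1 *: (Mx *m Mw) ->
    My *m Mz = (-1) ^+ e1 *: (Mz *m My) ->
    Mw *m My = (-1) ^+ e2 *: (My *m Mw) ->
    Mx *m My = (-1) ^+ e3 *: (My *m Mx) ->
    Mw *m Mz = Mz *m Mw -> Mx *m Mz = Mz *m Mx ->
  exists (s : seq 'rV[F]_d) (N : 'M[F]_d) (l : seq int),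
    [/\ size s = size l, (0 < size s)%N, uniq l & 0 \notin s]
    /\ (forall i, (i < size s)%N -> s`_i *m N = (l`_i)%:~R *: s`_i)
    /\ [/\ signed_stable s Mw, signed_stable s Mx,
           signed_stable s My & signed_stable s Mz].
Proof.
move=> d_gt0 [ww xx yy zz] wx yz wy xy wz xz.
have sgK (b : bool) : (-1) ^+ b * (-1) ^+ b = 1 :> F by rewrite -signr_addb addbb.
have act (M N : 'M[F]_d) (e : F) (u : 'rV_d) :
    M *m N = e *: (N *m M) -> u *m M *m N = e *: (u *m N *m M).
  by move=> MN; rewrite -mulmxA MN -scalemxAr mulmxA.
have inv (M : 'M[F]_d) : M *m M = 1%:M -> forall u : 'rV_d, u *m M *m M = u.
  by move=> MM u; rewrite -mulmxA MM mulmx1.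
have nz (M : 'M[F]_d) (u : 'rV_d) : M *m M = 1%:M -> u != 0 -> u *m M != 0.
  by move=> MM; apply: contraNneq => uM0; rewrite -(inv _ MM u) uM0 mul0mx.
have nz_v0 : delta_mx 0 (Ordinal d_gt0) != 0 :> 'rV[F]_d.
  apply/eqP=> /rowP/(_ (Ordinal d_gt0)); rewrite !mxE !eqxx; apply/eqP.
  exact: oner_neq0.
(* [Mx] and [Mz] commute in every case, so [v2] is a common eigenvector of both. *)
have [v1 [c [nz_v1 v1z _]]] := sign_eigenvector nz_v0 zz.
have [v2 [b [nz_v2 v2x /(_ _ _ xz v1z) v2z]]] := sign_eigenvector nz_v1 xx.
have yx : My *m Mx = (-1) ^+ e3 *: (Mx *m My).
  by rewrite xy scalerA sgK scale1r.
have yw : My *m Mw = (-1) ^+ e2 *: (Mw *m My).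
  by rewrite wy scalerA sgK scale1r.
case: e1 wx yz => wx yz.
  (* [Mw] flips the eigenvalue of [Mx] and keeps that of [Mz], whereas [My] flips that of [Mz]; the
     four vectors thus have different pairs of eigenvalues. *)
  pose v3 := v2 *m Mw; pose v4 := v2 *m My; pose v5 := v2 *m Mw *m My.
  have wz' : Mw *m Mz = 1 *: (Mz *m Mw) by rewrite scale1r.
  have v3x : v3 *m Mx = - (-1) ^+ b *: v3.
    by rewrite /v3 (act _ _ _ _ wx) v2x -scalemxAl scalerA mulN1r.
  have v3z : v3 *m Mz = (-1) ^+ c *: v3.
    by rewrite /v3 (act _ _ _ _ wz') v2z -scalemxAl scale1r.
  have v4x : v4 *m Mx = (-1) ^+ (e3 (+) b) *: v4.
    by rewrite /v4 (act _ _ _ _ yx) v2x -scalemxAl scalerA signr_addb.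
  have v4z : v4 *m Mz = - (-1) ^+ c *: v4.
    by rewrite /v4 (act _ _ _ _ yz) v2z -scalemxAl scalerA mulN1r.
  have v5x : v5 *m Mx = - (-1) ^+ (e3 (+) b) *: v5.
    by rewrite /v5 (act _ _ _ _ yx) v3x -scalemxAl scalerA signr_addb mulrN.
  have v5z : v5 *m Mz = - (-1) ^+ c *: v5.
    by rewrite /v5 (act _ _ _ _ yz) v3z -scalemxAl scalerA mulN1r.
  (* Mx + 2 Mz separates the four pairs of signs by which Mx and Mz act. *)
  pose l : seq int := [:: (-1) ^+ b + 2 * (-1) ^+ c; - (-1) ^+ b + 2 * (-1) ^+ c;
    (-1) ^+ (e3 (+) b) - 2 * (-1) ^+ c; - (-1) ^+ (e3 (+) b) - 2 * (-1) ^+ c].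
  exists [:: v2; v3; v4; v5], (Mx + 2 *: Mz), l; split.
    split=> //; first by rewrite /l; case: (b); case: (c); case: (e3).
    by rewrite !inE !negb_or !(eq_sym 0) nz_v2 !nz.
  split=> [[|[|[|[|//]]]] _ /=|].
  - by rewrite mulmxDr -scalemxAr v2x v2z scalerA -scalerDl !(rmorphD, rmorphN, rmorphM) /= !rmorph_sign.
  - by rewrite mulmxDr -scalemxAr v3x v3z scalerA -scalerDl !(rmorphD, rmorphN, rmorphM) /= !rmorph_sign.
  - by rewrite mulmxDr -scalemxAr v4x v4z scalerA -scalerDl mulrN !(rmorphD, rmorphN, rmorphM) /= !rmorph_sign.
  - by rewrite mulmxDr -scalemxAr v5x v5z scalerA -scalerDl mulrN !(rmorphD, rmorphN, rmorphM) /= !rmorph_sign.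
  split=> u; rewrite !inE => /or4P[] /eqP->.
  - by exists false, v3; rewrite ?inE ?eqxx ?orbT ?scale1r.
  - by exists false, v2; rewrite ?inE ?eqxx ?orbT ?scale1r ?inv.
  - by exists e2, v5; rewrite ?inE ?eqxx ?orbT // (act _ _ _ _ yw).
  - exists e2, v4; rewrite ?inE ?eqxx ?orbT //.
    by rewrite (act _ _ _ _ yw) inv.
  - by exists b, v2; rewrite ?inE ?eqxx ?orbT.
  - by exists (~~ b), v3; rewrite ?inE ?eqxx ?orbT // signrN.
  - by exists (e3 (+) b), v4; rewrite ?inE ?eqxx ?orbT.
  - by exists (~~ (e3 (+) b)), v5; rewrite ?inE ?eqxx ?orbT // signrN.
  - by exists false, v4; rewrite ?inE ?eqxx ?orbT ?scale1r.
  - by exists false, v5; rewrite ?inE ?eqxx ?orbT ?scale1r.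
  - by exists false, v2; rewrite ?inE ?eqxx ?orbT ?scale1r ?inv.
  - by exists false, v3; rewrite ?inE ?eqxx ?orbT ?scale1r ?inv.
  - by exists c, v2; rewrite ?inE ?eqxx ?orbT.
  - by exists c, v3; rewrite ?inE ?eqxx ?orbT.
  - by exists (~~ c), v4; rewrite ?inE ?eqxx ?orbT // signrN.
  - by exists (~~ c), v5; rewrite ?inE ?eqxx ?orbT // signrN.
(* Now [Mw], [Mx] and [Mz] commute pairwise, and [v3] is a common eigenvector of the three. *)
rewrite expr0 scale1r in wx; rewrite expr0 in yz.
have [v3 [a [nz_v3 v3w eig3]]] := sign_eigenvector nz_v2 ww.
have {}eig3 := (eig3 _ _ wx v2x, eig3 _ _ wz v2z).
have [v3x v3z] := eig3.
(* If neither sign occurs, [My] commutes with the rest as well and one common eigenvector is enough;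
   nothing has to be separated, so [N] is 0. *)
have [e23 | e23] := boolP (e2 || e3); last first.
  have [e20 e30] : e2 = false /\ e3 = false by case: (e2) (e3) e23 => [] [].
  rewrite e20 e30 !expr0 !scale1r in yw yx; rewrite scale1r in yz.
  have [v [b' [nz_v vy eig]]] := sign_eigenvector nz_v3 yy.
  exists [:: v], 0, [:: 0]; split.
    by split=> //; rewrite inE eq_sym.
  split=> [[|//] _ /=|]; first by rewrite mulmx0 scale0r.
  split=> u; rewrite inE => /eqP->.
  - by exists a, v; rewrite ?inE // (eig _ _ yw v3w).
  - by exists b, v; rewrite ?inE // (eig _ _ yx v3x).
  - by exists b', v; rewrite ?inE.
  - by exists c, v; rewrite ?inE // (eig _ _ yz v3z).
pose v4 := v3 *m My.
have v4w : v4 *m Mw = (-1) ^+ (e2 (+) a) *: v4.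
  by rewrite /v4 (act _ _ _ _ yw) v3w -scalemxAl scalerA signr_addb.
have v4x : v4 *m Mx = (-1) ^+ (e3 (+) b) *: v4.
  by rewrite /v4 (act _ _ _ _ yx) v3x -scalemxAl scalerA signr_addb.
have v4z : v4 *m Mz = (-1) ^+ c *: v4.
  by rewrite /v4 (act _ _ _ _ yz) v3z -scalemxAl scale1r.
(* [Mw] separates [v3] from [v4] if [e2] holds; otherwise [e3] holds and [Mx] separates them. *)
pose l : seq int := if e2 then [:: (-1) ^+ a; (-1) ^+ (e2 (+) a)]
  else [:: (-1) ^+ b; (-1) ^+ (e3 (+) b)].
exists [:: v3; v4], (if e2 then Mw else Mx), l; split.
  split=> //; first 1 [by rewrite /l; case: ifP];
    first by rewrite /l; case: (e2) e23; case: (e3); case: (a); case: (b).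
  by rewrite !inE !negb_or !(eq_sym 0) nz_v3 nz.
split=> [i lti|]; first by rewrite /l; case: (e2) v4w => v4w;
  case: i lti => [|[|//]] _ /=; rewrite rmorph_sign.
split=> u; rewrite !inE => /orP[] /eqP->.
- by exists a, v3; rewrite ?inE ?eqxx.
- by exists (e2 (+) a), v4; rewrite ?inE ?eqxx ?orbT.
- by exists b, v3; rewrite ?inE ?eqxx.
- by exists (e3 (+) b), v4; rewrite ?inE ?eqxx ?orbT.
- by exists false, v4; rewrite ?inE ?eqxx ?orbT ?scale1r.
- by exists false, v3; rewrite ?inE ?eqxx ?orbT ?scale1r ?inv.
- by exists c, v3; rewrite ?inE ?eqxx.
- by exists c, v4; rewrite ?inE ?eqxx ?orbT.
Qed.

(** * From the group to its quadratic map *)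

(* p is the composite of G -> G / Z(G) with G / Z(G) = V, and g is Z(G) = W;
   g is unconstrained outside the centre. *)
Record square_coordinates (m n : nat) (q : 'rV['F_2]_m -> 'rV['F_2]_n)
    (gT : finGroupType) (G : {group gT})
    (p : gT -> 'rV['F_2]_m) (g : gT -> 'rV['F_2]_n) : Prop := {
  coordM : {in G &, {morph p : x y / (x * y)%g >-> x + y}};
  coord_onto : forall v, exists2 x, x \in G & p x = v;
  coord_eq0 : {in G, forall x, (p x == 0) = (x \in 'Z(G)%g)};
  centerM : {in 'Z(G)%g &, {morph g : x y / (x * y)%g >-> x + y}};
  center_inj : {in 'Z(G)%g &, injective g};
  center_onto : forall w, exists2 z, z \in 'Z(G)%g & g z = w;
  coord_square : {in G, forall x, g (x ^+ 2)%g = q (p x)}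
}.

Lemma addvv_F2 n (v : 'rV['F_2]_n) : v + v = 0.
Proof. by rewrite -mulr2n -scaler_nat pchar_Zp // scale0r. Qed.

Lemma oppv_F2 n (v : 'rV['F_2]_n) : - v = v.
Proof. by apply/eqP; rewrite eq_sym -addr_eq0 addvv_F2. Qed.

Section Associated.

Variables (m n : nat) (q : 'rV['F_2]_m -> 'rV['F_2]_n).
Variables (gT : finGroupType) (G : {group gT}).

(** Total functions on [gT] replace morphisms on the quotient, so later computations avoid
    cosets. *)
Lemma associated_square_coordinates :
  associated_with q G -> exists p g, square_coordinates q G p g.
Proof.
case=> _ [f [g [/isomP[injf imf] /isomP[injg img] sq]]].
have nZ x : x \in G -> x \in 'N('Z(G))%g.
  by move=> Gx; apply: (subsetP (normal_norm (center_normal G))).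
exists (fun x => f (coset 'Z(G)%g x)), g; split=> //.
- by move=> x y Gx Gy; rewrite /= morphM ?nZ // morphM ?mem_quotient.
- move=> v; have: v \in (f @* (G / 'Z(G)))%g by rewrite imf inE.
  case/morphimP=> _ _ /morphimP[x _ Gx ->] ->; by exists x.
- move=> x Gx; have <- : (coset 'Z(G) x \in [1])%g = (x \in 'Z(G)%g).
    by rewrite inE; apply/eqP/idP=> [/coset_idr|/coset_id]; auto.
  rewrite inE; apply/eqP/eqP=> [fx0 | ->]; last exact: morph1.
  by apply: (injmP injf); rewrite ?mem_quotient ?group1 // morph1.
- by move=> x y Zx Zy; rewrite morphM.
- exact/injmP.
- move=> w; have: w \in (g @* 'Z(G))%g by rewrite img inE.
  by case/morphimP=> z _ Zz ->; exists z.
by move=> x Gx; rewrite sq.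
Qed.

Lemma associated_card : associated_with q G -> #|G| = (2 ^ m * 2 ^ n)%N.
Proof.
case=> _ [f [g [isof isog _]]].
have := card_isog (isom_isog _ (subxx _) isof).
have := card_isog (isom_isog _ (subxx _) isog).
rewrite !cardsT !card_mx card_Fp // !mul1n => cardZ cardGZ.
rewrite -(Lagrange (center_sub G)) -card_quotient ?normal_norm ?center_normal //.
by rewrite cardZ cardGZ mulnC.
Qed.

Variables (p : gT -> 'rV['F_2]_m) (g : gT -> 'rV['F_2]_n).
Hypothesis coordG : square_coordinates q G p g.

Lemma center_coord1 : g 1%g = 0.
Proof.
by apply: (addIr (g 1%g)); rewrite -(centerM coordG) ?group1 // mulg1 add0r.
Qed.

Lemma coord1 : p 1%g = 0.
Proof. by apply/eqP; rewrite (coord_eq0 coordG) ?group1. Qed.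

Lemma coordV x : x \in G -> p x^-1%g = p x.
Proof.
move=> Gx; apply/eqP; rewrite -subr_eq0 oppv_F2 -(coordM coordG) ?groupV //.
by rewrite mulVg coord1.
Qed.

Lemma square_center x : x \in G -> (x ^+ 2)%g \in 'Z(G)%g.
Proof.
move=> Gx; rewrite -(coord_eq0 coordG) ?groupX // expgS expg1.
by rewrite (coordM coordG) // addvv_F2.
Qed.

Lemma commg_center x y : x \in G -> y \in G -> [~ x, y]%g \in 'Z(G)%g.
Proof.
move=> Gx Gy; rewrite -(coord_eq0 coordG) ?groupR // commgEl.
rewrite (coordM coordG) ?groupV ?groupJ // conjgE !(coordM coordG) ?groupM ?groupV //.
by rewrite !coordV // (addrCA (p y)) addvv_F2 addr0 addvv_F2.
Qed.

(** Commutators are central, so [(y * x) ^+ 2 = y ^+ 2 * x ^+ 2 * [~ x, y]]; applying [g] turns this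
    into the definition of the polar form. *)
Lemma commg_polar x y : x \in G -> y \in G ->
  g [~ x, y]%g = polar q (p x) (p y).
Proof.
move=> Gx Gy; have Zxy := commg_center Gx Gy.
have cZ u : u \in G -> commute u [~ x, y]%g.
  by move=> Gu; apply: (centerC Gu Zxy).
have := expMg_Rmul 2 (cZ x Gx) (cZ y Gy); rewrite expg1 => /(congr1 g).
rewrite (coord_square coordG) ?groupM // (coordM coordG) //.
rewrite (centerM coordG (groupM (square_center Gy) (square_center Gx)) Zxy).
rewrite (centerM coordG (square_center Gy) (square_center Gx)).
rewrite !(coord_square coordG) // => sq.
by rewrite /polar [p x + _]addrC sq -addrA -opprD [q (p x) + _]addrC addrC addKr.
Qed.

Lemma center_square1 z : z \in 'Z(G)%g -> (z ^+ 2 = 1)%g.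
Proof.
move=> Zz; apply: (center_inj coordG); rewrite ?group1 ?groupX //.
by rewrite expgS expg1 (centerM coordG) // addvv_F2 center_coord1.
Qed.

Lemma coord_inj_center x y : x \in G -> y \in G -> p x = p y ->
  exists2 z, z \in 'Z(G)%g & x = (z * y)%g.
Proof.
move=> Gx Gy pxy; exists (x * y^-1)%g; last by rewrite mulgKV.
by rewrite -(coord_eq0 coordG) ?groupM ?groupV // (coordM coordG) ?groupV //
  coordV // pxy addvv_F2.
Qed.

(** If [y] lifts [u], then [[~ x, y] = x ^+ 2], so [x ^ y = x ^+ 3]; this is the inverse of [x], as
    the central element [x ^+ 2] squares to 1. *)
Lemma coord_real :
  (forall v, exists u, polar q v u = q v) -> real_group G.
Proof.
move=> polq x Gx; have [u pxu] := polq (p x).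
have [y Gy py] := coord_onto coordG u; apply/imsetP; exists y => //.
have xy : [~ x, y]%g = (x ^+ 2)%g.
  apply: (center_inj coordG); rewrite ?commg_center ?square_center //.
  by rewrite commg_polar // py pxu (coord_square coordG).
have -> : (x ^ y = x * [~ x, y])%g by rewrite commgEl mulKVg.
rewrite xy -[LHS]mulg1 -(center_square1 (square_center Gx)) !expgS expg0.
by rewrite !mulg1 -!mulgA mulKg.
Qed.

(** An element equal to its inverse squares to 1, hence lies over a zero of [q]. *)
Lemma coord_strongly_real :
  strongly_real G ->
  forall v, exists u1 u2, [/\ q u1 = 0, q u2 = 0 & v = u1 + u2].
Proof.
move=> srG v; have [x Gx <-] := coord_onto coordG v.
have [a [b [Ga Gb aV bV ->]]] := srG x Gx.
have qp0 c : c \in G -> (c^-1 = c)%g -> q (p c) = 0.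
  move=> Gc cV; rewrite -(coord_square coordG) // expgS expg1.
  by rewrite -{1}cV mulVg center_coord1.
by exists (p a), (p b); rewrite !qp0 // (coordM coordG).
Qed.

End Associated.

(** * Computations with the example in coordinates *)

Lemma F2_case (a : 'F_2) : a = 0 \/ a = 1.
Proof. by case: a => [[|[|//]] lt_a]; [left | right]; apply: val_inj. Qed.

Definition vec4 (a b c d : 'F_2) : 'rV['F_2]_4 := \row_(i < 4) [:: a; b; c; d]`_i.

Definition vec3 (a b c : 'F_2) : 'rV['F_2]_3 := \row_(i < 3) [:: a; b; c]`_i.

Lemma vec4P (v : 'rV['F_2]_4) : exists a b c d, v = vec4 a b c d.
Proof.
exists (v 0 0), (v 0 1), (v 0 2), (v 0 3); apply/rowP.
by case=> [[|[|[|[|//]]]] ?]; rewrite mxE /=; congr (v _ _); apply: val_inj.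
Qed.

Lemma vec3P (w : 'rV['F_2]_3) : exists a b c, w = vec3 a b c.
Proof.
exists (w 0 0), (w 0 1), (w 0 2); apply/rowP.
by case=> [[|[|[|//]]] ?]; rewrite mxE /=; congr (w _ _); apply: val_inj.
Qed.

Lemma vec4_inj a b c d a' b' c' d' :
  vec4 a b c d = vec4 a' b' c' d' -> [/\ a = a', b = b', c = c' & d = d'].
Proof.
move=> /rowP e; move: (e 0) (e 1) (e 2) (e 3).
by rewrite !mxE.
Qed.

Lemma vec3_inj a b c a' b' c' :
  vec3 a b c = vec3 a' b' c' -> [/\ a = a', b = b' & c = c'].
Proof. by move=> /rowP e; move: (e 0) (e 1) (e 2); rewrite !mxE. Qed.

Lemma add_vec4 a b c d a' b' c' d' :
  vec4 a b c d + vec4 a' b' c' d' = vec4 (a + a') (b + b') (c + c') (d + d').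
Proof. by apply/rowP; case=> [[|[|[|[|//]]]] ?]; rewrite !mxE. Qed.

Lemma add_vec3 a b c a' b' c' :
  vec3 a b c + vec3 a' b' c' = vec3 (a + a') (b + b') (c + c').
Proof. by apply/rowP; case=> [[|[|[|//]]] ?]; rewrite !mxE. Qed.

Lemma scale_vec4 k a b c d : k *: vec4 a b c d = vec4 (k * a) (k * b) (k * c) (k * d).
Proof. by apply/rowP; case=> [[|[|[|[|//]]]] ?]; rewrite !mxE. Qed.

Lemma scale_vec3 k a b c : k *: vec3 a b c = vec3 (k * a) (k * b) (k * c).
Proof. by apply/rowP; case=> [[|[|[|//]]] ?]; rewrite !mxE. Qed.

Lemma opp_vec3 a b c : - vec3 a b c = vec3 (- a) (- b) (- c).
Proof. by apply/rowP; case=> [[|[|[|//]]] ?]; rewrite !mxE. Qed.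

Lemma vec3_0 : 0 = vec3 0 0 0.
Proof. by apply/rowP; case=> [[|[|[|//]]] ?]; rewrite !mxE. Qed.

Lemma vec4_0 : 0 = vec4 0 0 0 0.
Proof. by apply/rowP; case=> [[|[|[|[|//]]]] ?]; rewrite !mxE. Qed.

Lemma q_exampleE w x y z :
  q_example (vec4 w x y z) = vec3 (w * x + y * z) (w * y) (x * y).
Proof. by rewrite /q_example !mxE. Qed.

Lemma polar_q_exampleE w x y z w' x' y' z' :
  polar q_example (vec4 w x y z) (vec4 w' x' y' z') =
    vec3 (w * x' + w' * x + (y * z' + y' * z)) (w * y' + w' * y) (x * y' + x' * y).
Proof.
rewrite /polar add_vec4 !q_exampleE !opp_vec3 !add_vec3.
by congr vec3; ring.
Qed.

Lemma q_example_quadratic : quadratic_map q_example.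
Proof.
split=> [a v|v a u1 u2|v a u1 u2].
- have [w [x [y [z ->]]]] := vec4P v.
  by rewrite scale_vec4 !q_exampleE scale_vec3; congr vec3; ring.
- have [? [? [? [? ->]]]] := vec4P v; have [? [? [? [? ->]]]] := vec4P u1.
  have [? [? [? [? ->]]]] := vec4P u2.
  rewrite scale_vec4 add_vec4 !polar_q_exampleE scale_vec3 add_vec3.
  by congr vec3; ring.
have [? [? [? [? ->]]]] := vec4P v; have [? [? [? [? ->]]]] := vec4P u1.
have [? [? [? [? ->]]]] := vec4P u2.
rewrite scale_vec4 add_vec4 !polar_q_exampleE scale_vec3 add_vec3.
by congr vec3; ring.
Qed.

(** The first component of the polar form is already nondegenerate: against the four basis vectors
    it returns [x], [w], [z] and [y]. *)
Lemma q_example_regular : regular_map q_example.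
Proof.
move=> v; have [w [x [y [z ->]]]] := vec4P v => polar0.
move: (polar0 (vec4 1 0 0 0)) (polar0 (vec4 0 1 0 0)).
move: (polar0 (vec4 0 0 1 0)) (polar0 (vec4 0 0 0 1)).
rewrite !polar_q_exampleE vec3_0 vec4_0.
move=> /vec3_inj[+ _ _] /vec3_inj[+ _ _] /vec3_inj[+ _ _] /vec3_inj[+ _ _].
by rewrite !(mul0r, mul1r, add0r, addr0, mulr1, mulr0) => -> -> -> ->.
Qed.

(** The pairs [(e_w, e_x)], [(e_w, e_y)], [(e_x, e_y)] have the standard basis of W as polar values.
    This serves both for the span and for writing central elements as products of commutators. *)
Lemma vec3_polar_sum a b c : vec3 a b c =
  polar q_example (vec4 a 0 0 0) (vec4 0 1 0 0) +
  polar q_example (vec4 b 0 0 0) (vec4 0 0 1 0) +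
  polar q_example (vec4 0 c 0 0) (vec4 0 0 1 0).
Proof. by rewrite !polar_q_exampleE !add_vec3; congr vec3; ring. Qed.

Lemma q_example_polar_span : polar_span q_example = [set: 'rV['F_2]_3].
Proof.
apply/setP=> w; rewrite inE; have [a [b [c ->]]] := vec3P w.
have gen u v : polar q_example u v \in polar_span q_example.
  by apply/mem_gen/imset2P; exists u v.
rewrite vec3_polar_sum.
exact: groupM (groupM (gen _ _) (gen _ _)) (gen _ _).
Qed.

Lemma q_example_polar_onto_self v : exists u, polar q_example v u = q_example v.
Proof.
(* With third coordinate 0, the last two components become [w' * y] and [x' * y], matched by
   [w' = w * y] and [x' = x] since [y * y = y]. The first is then [w * x + w * x * y + y * z'],
   which [z' = w * x + z] corrects. *)
have [w [x [y [z ->]]]] := vec4P v; exists (vec4 (w * y) x 0 (w * x + z)).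
rewrite polar_q_exampleE q_exampleE.
by case: (F2_case w) (F2_case x) (F2_case y) (F2_case z)
  => -> [] -> [] -> [] ->; congr vec3; apply/eqP.
Qed.

(** Exactly one summand would have third coordinate 1; its last two components force [w = x = 0].
    The other then has [w = x = 1] and [y = 0], so its first component is 1. *)
Lemma q_example_not_singular_sum u1 u2 :
  q_example u1 = 0 -> q_example u2 = 0 -> u1 + u2 <> vec4 1 1 1 0.
Proof.
have [w [x [y [z ->]]]] := vec4P u1; have [w' [x' [y' [z' ->]]]] := vec4P u2.
rewrite !q_exampleE vec3_0 add_vec4.
move=> /vec3_inj[q1 q2 q3] /vec3_inj[r1 r2 r3] /vec4_inj[] ww xx yy _.
have {ww}ww : w' = 1 - w by rewrite -ww addrC addKr.
have {xx}xx : x' = 1 - x by rewrite -xx addrC addKr.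
have {yy}yy : y' = 1 - y by rewrite -yy addrC addKr.
move: q1 q2 q3 r1 r2 r3; rewrite ww xx yy {ww xx yy}.
by case: (F2_case w) (F2_case x) (F2_case y) (F2_case z) (F2_case z')
  => -> [] -> [] -> [] -> [] -> //.
Qed.

(** * Existence of the associated group as a central extension *)

(** Each monomial of [q_example] takes its first factor from [v] and its second from [u]. The result
    is bilinear, hence a 2-cocycle, with [q_example] on the diagonal. *)
Definition cocycle (v u : 'rV['F_2]_4) : 'rV['F_2]_3 :=
  vec3 (v 0 0 * u 0 1 + v 0 2 * u 0 3) (v 0 0 * u 0 2) (v 0 1 * u 0 2).

Lemma cocycleDl u v1 v2 : cocycle (v1 + v2) u = cocycle v1 u + cocycle v2 u.
Proof. by rewrite /cocycle add_vec3 !mxE; congr vec3; ring. Qed.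

Lemma cocycleDr u v1 v2 : cocycle u (v1 + v2) = cocycle u v1 + cocycle u v2.
Proof. by rewrite /cocycle add_vec3 !mxE; congr vec3; ring. Qed.

Lemma cocycle0l u : cocycle 0 u = 0.
Proof. by apply: (addIr (cocycle 0 u)); rewrite -cocycleDl !add0r. Qed.

Lemma cocycle0r u : cocycle u 0 = 0.
Proof. by apply: (addIr (cocycle u 0)); rewrite -cocycleDr !add0r. Qed.

Lemma cocycle_diag v : cocycle v v = q_example v.
Proof. by []. Qed.

Lemma polar_cocycle v u : polar q_example v u = cocycle v u + cocycle u v.
Proof.
rewrite /polar -!cocycle_diag cocycleDl !cocycleDr -addrA -opprD.
by rewrite (addrC (cocycle v v)) addrACA addrK.
Qed.

(** A separate name lets the set V x W carry the twisted law rather than a componentwise one. *)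
Definition extension : Type := ('rV['F_2]_4 * 'rV['F_2]_3)%type.

HB.instance Definition _ := Finite.on extension.

Definition extension_mul (x y : extension) : extension :=
  (x.1 + y.1, cocycle x.1 y.1 + x.2 + y.2).

Definition extension_inv (x : extension) : extension :=
  (x.1, cocycle x.1 x.1 + x.2).

Lemma extension_mulA : associative extension_mul.
Proof.
move=> x y z; congr (_, _) => /=; first by rewrite addrA.
rewrite cocycleDl cocycleDr.
move: (cocycle _ _) (cocycle _ _) (cocycle _ _) => cxy cxz cyz.
by apply/rowP=> i; rewrite !mxE; ring.
Qed.

Lemma extension_mul1 : left_id ((0, 0) : extension) extension_mul.
Proof. by case=> v w; rewrite /extension_mul /= cocycle0l !add0r. Qed.

Lemma extension_mulV :
  left_inverse ((0, 0) : extension) extension_inv extension_mul.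
Proof.
by case=> v w; rewrite /extension_mul /= addvv_F2 addrA addvv_F2 add0r addvv_F2.
Qed.

HB.instance Definition _ := Finite_isGroup.Build extension
  extension_mulA extension_mul1 extension_mulV.

Lemma extension_mulE (x y : extension) :
  (x * y)%g = (x.1 + y.1, cocycle x.1 y.1 + x.2 + y.2) :> extension.
Proof. by []. Qed.

Lemma extension_square (x : extension) : (x ^+ 2)%g = (0, q_example x.1) :> extension.
Proof.
by rewrite expgS expg1 extension_mulE -addrA !addvv_F2 addr0 cocycle_diag.
Qed.

Lemma extension_commg (x y : extension) :
  [~ x, y]%g = (0, polar q_example x.1 y.1) :> extension.
Proof.
(* Comparing [x * y] with [y * x * [~ x, y]] avoids computing inverses. *)
apply: (mulgI (y * x)%g); rewrite -commgC !extension_mulE /=.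
rewrite addr0 cocycle0r add0r [y.1 + _]addrC polar_cocycle.
congr (_, _).
rewrite (addrC (cocycle x.1 y.1) (cocycle _ _)) [in RHS]addrACA.
rewrite (addrC (cocycle y.1 x.1) y.2) -(addrA y.2) addvv_F2 addr0.
by rewrite (addrC x.2) [RHS]addrC.
Qed.

Lemma extension_centerE (x : extension) :
  (x \in 'Z([set: extension]))%g = (x.1 == 0).
Proof.
apply/centerP/eqP=> [[_ cx] | x0].
  apply: q_example_regular => v.
  have /commgP/eqP := cx (v, 0) (in_setT _).
  (* The commutator is reversed because [regular_map] fixes the second argument of the polar
     form. *)
  rewrite -invg_comm => /(congr1 invg); rewrite invgK invg1 extension_commg.
  by case.
split=> [|y _]; first exact: in_setT.
apply/commgP/eqP; rewrite extension_commg x0 polar_cocycle.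
by rewrite cocycle0l cocycle0r addr0.
Qed.

(** The centre lies in the derived subgroup because polar values span W, and the derived subgroup
    lies in the Frattini subgroup. The latter is generated by commutators and squares, all of which
    have first coordinate 0, so the chain closes up. *)
Lemma extension_special : special_2group [set: extension].
Proof.
have card : #|[set: extension]| = (2 ^ 7)%N.
  by rewrite cardsT card_prod !card_mx card_Fp.
have pG : (2.-group [set: extension])%g by rewrite /pgroup card pnatX.
have sZ' : ('Z([set: extension]) \subset [set: extension]^`(1))%g.
  apply/subsetP=> -[v w]; rewrite extension_centerE /= => /eqP->.
  have [a [b [c ->]]] := vec3P w; rewrite vec3_polar_sum.
  set u1 := vec4 a 0 0 0; set u2 := vec4 0 1 0 0; set u3 := vec4 b 0 0 0.
  set u4 := vec4 0 0 1 0; set u5 := vec4 0 c 0 0.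
  pose lift u : extension := (u, 0).
  have -> : (0, polar q_example u1 u2 + polar q_example u3 u4
                + polar q_example u5 u4) =
    ([~ lift u1, lift u2] * [~ lift u3, lift u4] * [~ lift u5, lift u4])%g.
    by rewrite !extension_commg !extension_mulE /= !addr0 !cocycle0r !add0r.
  rewrite derg1; have comm (y z : extension) := mem_commg (in_setT y) (in_setT z).
  exact: groupM (groupM (comm _ _) (comm _ _)) (comm _ _).
have s'Phi : ([set: extension]^`(1) \subset 'Phi([set: extension]))%g.
  by rewrite (Phi_joing pG) joing_subl.
have sPhiZ : ('Phi([set: extension]) \subset 'Z([set: extension]))%g.
  rewrite (Phi_joing pG) (MhoE _ pG) join_subG !gen_subG; apply/andP; split.
    by apply/subsetP=> _ /imset2P[x y _ _ ->]; rewrite extension_centerE extension_commg.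
  by apply/subsetP=> _ /imsetP[x _ ->]; rewrite extension_centerE extension_square.
have ePhi : ('Phi([set: extension]) = 'Z([set: extension]))%g.
  by apply/eqP; rewrite eqEsubset sPhiZ (subset_trans sZ' s'Phi).
split=> //.
- apply/negP=> /center_idP/setP/(_ (vec4 1 0 0 0, 0)).
  by rewrite extension_centerE in_setT vec4_0 => /eqP/vec4_inj[].
- by apply/eqP; rewrite eqEsubset s'Phi ePhi sZ'.
apply/eqP; rewrite eqEsubset gen_subG subsetIl andbT.
apply/subsetP=> x Zx; apply: mem_gen; rewrite in_setI Zx inE.
rewrite extension_centerE in Zx; rewrite extension_square (eqP Zx).
by apply/eqP; rewrite -cocycle_diag cocycle0l.
Qed.

(** The first projection has the centre as kernel and factors through the quotient; the second is
    multiplicative on the centre, where the cocycle vanishes. *)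
Lemma extension_associated :
  exists (gT : finGroupType) (G : {group gT}), associated_with q_example G.
Proof.
exists extension, [set: extension]%G; split; first exact: extension_special.
have fstM : {in [set: extension] &, {morph (fun x : extension => x.1) :
    x y / (x * y)%g >-> (x * y)%g}} by [].
have sndM : {in 'Z([set: extension])%g &, {morph (fun x : extension => x.2) :
    x y / (x * y)%g >-> (x * y)%g}}.
  move=> x y; rewrite !extension_centerE => /eqP x0 _.
  by rewrite extension_mulE /= x0 cocycle0l add0r.
pose fst_m := Morphism fstM; pose snd_m := Morphism sndM.
have ker_fst : ('ker fst_m = 'Z([set: extension]))%g.
  by apply/setP=> x; rewrite extension_centerE !inE.
have sK : ('ker (coset 'Z([set: extension])) \subset 'ker fst_m)%g.
  by rewrite ker_coset ker_fst.
have sN : ([set: extension] \subset 'N('Z([set: extension])))%g.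
  exact: normal_norm (center_normal _).
exists (factm_morphism sK sN), snd_m; split.
- apply/isomP; split.
    by rewrite ker_factm ker_fst; apply/trivgP; exact: trivg_quotient.
  rewrite morphim_factm; apply/setP=> v; rewrite !inE; apply/morphimP.
  by exists (v, 0) => //; rewrite in_setT.
- apply/isomP; split.
    apply/injmP=> -[v w] [v' w']; rewrite !extension_centerE /=.
    by move=> /eqP-> /eqP-> ->.
  apply/setP=> w; rewrite !inE; apply/morphimP.
  by exists (0, w); rewrite ?extension_centerE.
move=> x Gx; rewrite extension_square.
by congr q_example; apply: (factmE sK sN Gx).
Qed.

(** * Irreducible representations of an associated group *)

(** By Schur's lemma [rG z - 1%:M] is zero or invertible; in the second case it cancels from
    [(rG z - 1%:M) *m (rG z + 1%:M) = 0]. *)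
Lemma irreducible_central_involution (F : fieldType) (gT : finGroupType)
    (G : {group gT}) d (rG : mx_representation F G d) z :
    mx_irreducible rG -> z \in 'Z(G)%g -> (z ^+ 2 = 1)%g ->
  exists b : bool, rG z = (-1) ^+ b *: 1%:M.
Proof.
move=> irrG /centerP[Gz cz] zz.
have rzz : rG z *m rG z = 1%:M by rewrite -repr_mxM // -[(z * z)%g]/(z ^+ 2)%g zz repr_mx1.
have [rz1 | nz] := eqVneq (rG z - 1%:M) 0.
  by exists false; rewrite scale1r; apply: subr0_eq.
have uz : rG z - 1%:M \in unitmx.
  apply: (mx_Schur irrG) nz; apply/centgmxP=> x Gx.
  by rewrite mulmxBl mulmxBr mul1mx mulmx1 -!repr_mxM // cz.
exists true; rewrite scaleN1r; apply/eqP; rewrite -addr_eq0.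
rewrite -[_ + _](mulKmx uz) mulmxDr mulmx1 mulmxBl rzz mul1mx.
by rewrite addrA subrK subrr mulmx0.
Qed.

Section Realizability.

Variables (K : fieldType) (F : numFieldType) (f : {rmorphism K -> F}).
Variables (gT : finGroupType) (G : {group gT}).
Variables (p : gT -> 'rV['F_2]_4) (g : gT -> 'rV['F_2]_3).
Hypothesis coordG : square_coordinates q_example G p g.
Variables (d : nat) (rG : mx_representation F G d).
Hypothesis irrG : mx_irreducible rG.

Lemma repr_commute_sign x y : x \in G -> y \in G ->
  forall b : bool, rG [~ x, y]%g = (-1) ^+ b *: 1%:M ->
  rG x *m rG y = (-1) ^+ b *: (rG y *m rG x).
Proof.
move=> Gx Gy b rxy; rewrite -repr_mxM // commgC.
rewrite (repr_mxM rG (groupM Gy Gx) (groupR Gx Gy)) rxy.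
by rewrite -scalemxAr mulmx1 repr_mxM.
Qed.

Lemma q_example_realizable :
  exists rK : mx_representation K G d, mx_rsim rG (map_repr f rK).
Proof.
have [w Gw pw] := coord_onto coordG (vec4 1 0 0 0).
have [x Gx px] := coord_onto coordG (vec4 0 1 0 0).
have [y Gy py] := coord_onto coordG (vec4 0 0 1 0).
have [z Gz pz] := coord_onto coordG (vec4 0 0 0 1).
have sq h : h \in G -> q_example (p h) = 0 -> rG h *m rG h = 1%:M.
  move=> Gh qh; rewrite -repr_mxM // -(repr_mx1 rG); congr (rG _).
  apply: (center_inj coordG); rewrite ?group1 //.
    exact: (square_center coordG Gh).
  by rewrite (center_coord1 coordG) -qh -(coord_square coordG).
have comm_eq h1 h2 h3 h4 : h1 \in G -> h2 \in G -> h3 \in G -> h4 \in G ->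
    polar q_example (p h1) (p h2) = polar q_example (p h3) (p h4) ->
    [~ h1, h2]%g = [~ h3, h4]%g.
  move=> G1 G2 G3 G4 eqp; apply: (center_inj coordG);
    rewrite ?(commg_center coordG) //.
  by rewrite !(commg_polar coordG).
have sgn h1 h2 : h1 \in G -> h2 \in G ->
    exists b : bool, rG [~ h1, h2]%g = (-1) ^+ b *: 1%:M.
  move=> G1 G2; have Z12 := commg_center coordG G1 G2.
  exact: irreducible_central_involution (center_square1 coordG Z12).
have [e1 s1] := sgn w x Gw Gx; have [e2 s2] := sgn w y Gw Gy.
have [e3 s3] := sgn x y Gx Gy.
(* Both commutators correspond to [vec3 1 0 0], so the single sign [e1] governs both pairs. *)
have yz : [~ y, z]%g = [~ w, x]%g.
  apply: comm_eq => //; rewrite pw px py pz !polar_q_exampleE.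
  by congr vec3; apply/eqP.
have commute_z h : h \in G -> polar q_example (p h) (p z) = 0 ->
    rG h *m rG z = rG z *m rG h.
  move=> Gh bhz; rewrite (@repr_commute_sign h z Gh Gz false) ?scale1r //.
  (* The trivial commutator [[~ h, h]] represents 1, so that [comm_eq] applies. *)
  rewrite (comm_eq h z h h) // ?commgg ?repr_mx1 // bhz.
  by rewrite polar_cocycle addvv_F2.
have vec0 a b c : a = 0 -> b = 0 -> c = 0 -> vec3 a b c = 0.
  by move=> -> -> ->; rewrite vec3_0.
have [||||||||s [N [l [[sz s_gt0 ul nzs] [eig [sw sx sy s_z]]]]]] :=
    @signed_frame_of_generators F d (rG w) (rG x) (rG y) (rG z) e1 e2 e3.
- by case/mx_irrP: irrG.
- by split; apply: sq => //; rewrite ?pw ?px ?py ?pz q_exampleE; apply: vec0;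
    apply/eqP.
- exact: repr_commute_sign.
- by apply: repr_commute_sign => //; rewrite yz.
- exact: repr_commute_sign.
- exact: repr_commute_sign.
- by apply: commute_z; rewrite // pw pz polar_q_exampleE; apply: vec0; apply/eqP.
- by apply: commute_z; rewrite // px pz polar_q_exampleE; apply: vec0; apply/eqP.
apply: (signed_frame_realizable f irrG sz s_gt0 ul nzs eig) => h Gh.
have stabM h1 h2 : h1 \in G -> h2 \in G -> signed_stable s (rG h1) ->
    signed_stable s (rG h2) -> signed_stable s (rG (h1 * h2)%g).
  by move=> G1 G2 s1' s2'; rewrite repr_mxM //; apply: signed_stableM.
have stabX h1 k : h1 \in G -> signed_stable s (rG h1) ->
    signed_stable s (rG (h1 ^+ k)%g).
  move=> G1 s1'; elim: k => [|k IHk]; first by rewrite repr_mx1; apply: signed_stable1.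
  by rewrite expgS; apply: stabM; rewrite ?groupX.
have coordX h1 k : h1 \in G -> p (h1 ^+ k)%g = k%:R *: p h1.
  move=> G1; elim: k => [|k IHk]; first by rewrite (coord1 coordG) scale0r.
  by rewrite expgS (coordM coordG) ?groupX // IHk mulrS scalerDl scale1r.
(* The coordinates of [p h], read as natural numbers, are the exponents of a product of the four
   lifts that agrees with [h] up to a central factor [t], which acts by a sign. *)
have [a [b [c [e ph]]]] := vec4P (p h).
have [||t Zt ->] :=
    @coord_inj_center _ _ _ _ _ _ _ coordG h (w ^+ a * x ^+ b * y ^+ c * z ^+ e)%g Gh.
- by rewrite !groupM ?groupX.
- rewrite !(coordM coordG) ?groupM ?groupX // !coordX // pw px py pz ph.
  rewrite !scale_vec4 !add_vec4 !natr_Zp.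
  by rewrite !(mulr0, mulr1, addr0, add0r).
have [b' st] := irreducible_central_involution irrG Zt (center_square1 coordG Zt).
have Gt : t \in G by apply: (subsetP (center_sub G)).
apply: (stabM) => //; first by rewrite !groupM ?groupX.
  by rewrite st; apply/signed_stableZ/signed_stable1.
by do ![apply: (stabM); rewrite ?groupM ?groupX //]; apply: (stabX).
Qed.

End Realizability.

Local Close Scope ring_scope.

Theorem mainTheorem4 :
  [/\ quadratic_map q_example,
      regular_map q_example
    & polar_span q_example = [set: 'rV['F_2]_3]] /\
  (exists (gT : finGroupType) (G : {group gT}), associated_with q_example G) /\
  (forall (R : realType) (gT : finGroupType) (G : {group gT}),
     associated_with q_example G ->
     [/\ #|G| = 128, totally_orthogonal R G & ~ strongly_real G]).
Proof.
split.
  split; [exact: q_example_quadratic | exact: q_example_regular |].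
  exact: q_example_polar_span.
split=> [|R gT G assocG]; first exact: extension_associated.
have [p [g coordG]] := associated_square_coordinates assocG.
split; first by rewrite (associated_card assocG).
  split=> [|d rG irrG]; last exact: (q_example_realizable _ coordG irrG).
  by apply: (coord_real coordG) => v; apply: q_example_polar_onto_self.
move=> /(coord_strongly_real coordG)/(_ (vec4 1 1 1 0)%R)[u1 [u2 [q1 q2 /esym]]].
exact: q_example_not_singular_sum.
Qed.
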